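(* Let $d\ge2$, $\epsilon\in(0,1]$, and let $\nu$ be a probability measure on $\mathrm{U}(d)$ which is an exact unitary $t$-design with $$t\ge 5\frac{d^{5/2}}{\epsilon}\,\tau(\epsilon,d),\qquad \tau(\epsilon,d)=\log\!\left(\tfrac{6C}{\epsilon}\right)^{1/2}\sqrt{\tfrac{1}{32}\log\!\left(\tfrac{6C}{\epsilon}\right)^{1/2}+\log\!\left(\tfrac{d}{\epsilon}\log\!\left(\tfrac{6C}{\epsilon}\right)^{1/2}\right)},$$ where $C=5\pi$. Then the set of unitary channels $\{\mathcal{V}: V\in\mathrm{supp}(\nu)\}$ is an $\epsilon$-net in $\mathcal{U}(d)$ with respect to the distance $\mathrm{D}$.
   Context: $\mathcal{U}(d)$ is the set of unitary channels $\rho\mapsto U\rho U^\dagger$ on $\mathbb{C}^d$; $\mathcal{V}$ denotes the channel of the unitary $V$. $\mathrm{D}(\mathcal{U},\mathcal{V})=\min_{\varphi\in[0,2\pi)}\|U-e^{i\varphi}V\|_\infty$ (operator norm). A subset $S\subset\mathcal{U}(d)$ is an $\epsilon$-net if for every $\mathcal{U}\in\mathcal{U}(d)$ there is $\mathcal{V}\in S$ with $\mathrm{D}(\mathcal{U},\mathcal{V})\le\epsilon$. $\nu$ is an exact $t$-design if $\int\mathrm{d}\nu(U)\,G(U)=\int\mathrm{d}\mu(U)\,G(U)$ for every function $G(U)=\mathrm{tr}(A\,U^{\otimes t}\otimes\bar U^{\otimes t})$, $A$ an operator on $(\mathbb{C}^d)^{\otimes 2t}$, where $\mu$ is the Haar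 probability measure on $\mathrm{U}(d)$. $\log$ is the natural logarithm. *)

(* Defs.v *)
From HB Require Import structures.
From mathcomp Require Import all_boot all_order all_algebra.
From mathcomp Require Import all_classical all_reals all_analysis.
From mathcomp.real_closed Require Import complex mxtens.

Set Implicit Arguments.
Unset Strict Implicit.
Unset Printing Implicit Defensive.

Import Order.TTheory GRing.Theory Num.Theory.
Local Open Scope classical_set_scope.
Local Open Scope ring_scope.

Section UnitaryGroup.
Variables (R : realType) (d : nat).

Definition adjmx (U : 'M[R[i]]_d) : 'M[R[i]]_d := map_mx conjc U^T.

Definition is_unitary (U : 'M[R[i]]_d) : bool := U *m adjmx U == 1%:M.

Record unitary_mx := Unitary { umx :> 'M[R[i]]_d; umxP : is_unitary umx }.
HB.instance Definition _ := [isSub for umx].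
HB.instance Definition _ := [Choice of unitary_mx by <:].

Lemma is_unitary1 : is_unitary 1%:M.
Proof. by rewrite /is_unitary /adjmx trmx1 map_mx1 mul1mx. Qed.

HB.instance Definition _ := isPointed.Build unitary_mx (Unitary is_unitary1).

Definition vnorm (v : 'cV[R[i]]_d) : R :=
  Num.sqrt (\sum_(k < d) (complex.Re (v k 0) ^+ 2 + complex.Im (v k 0) ^+ 2)).

Definition opnorm (A : 'M[R[i]]_d) : R :=
  sup [set vnorm (A *m v) | v in [set v : 'cV[R[i]]_d | vnorm v = 1]].

Definition phase (phi : R) : R[i] := (cos phi +i* sin phi)%C.

Definition Dch (U V : 'M[R[i]]_d) : R :=
  inf [set opnorm (U - phase phi *: V) | phi in `[0, 2 * pi[%classic].

Definition uopen (A : set unitary_mx) : Prop :=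
  forall U, A U -> exists2 r : R, 0 < r &
    forall V : unitary_mx, opnorm (val U - val V) < r -> A V.

End UnitaryGroup.

Notation UBorel R d := (g_sigma_algebraType (@uopen R d)).

Definition isHaar (R : realType) (d : nat) (mu : probability (UBorel R d) R) : Prop :=
  forall (W : UBorel R d) (A : set (UBorel R d)), measurable A ->
    mu [set U : UBorel R d | exists2 V, A V & val U = val W *m val V] = mu A.

Definition Gfun (R : realType) (d t : nat) (A : 'M[R[i]]_(d ^ t * d ^ t))
  (U : UBorel R d) : R[i] :=
  \tr (A *m (ntensmx (val U) t *t ntensmx (map_mx conjc (val U)) t)).

Definition exact_design (R : realType) (d t : nat)
  (mu nu : probability (UBorel R d) R) : Prop :=
  forall A : 'M[R[i]]_(d ^ t * d ^ t),
    (\int[nu]_U (complex.Re (Gfun A U))%:E = \int[mu]_U (complex.Re (Gfun A U))%:E)%E /\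
    (\int[nu]_U (complex.Im (Gfun A U))%:E = \int[mu]_U (complex.Im (Gfun A U))%:E)%E.

Definition msupport (R : realType) (d : nat) (nu : probability (UBorel R d) R)
  : set (UBorel R d) :=
  [set U | forall O : set (UBorel R d), uopen O -> O U -> (0 < nu O)%E].

Definition is_eps_net (R : realType) (d : nat) (S : set (UBorel R d)) (eps : R) : Prop :=
  forall U : UBorel R d, exists2 V, S V & Dch (val U) (val V) <= eps.

Definition tau (R : realType) (eps : R) (d : nat) : R :=
  let C := 5 * pi in
  let L := Num.sqrt (ln (6 * C / eps)) in
  L * Num.sqrt (L / 32 + ln (d%:R / eps * L)).

(* Main.v *)
(** The fidelity x(V) = |tr(U^* V)|^2 / d^2 is a polynomial of bidegree (1,1) in
    the entries of V and of its conjugate, so a t-design integrates every real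
    polynomial of degree at most t in x exactly.  If no point of the support
    were eps-close to U, then x <= a := (1 - eps^2 / (2 d))^2 on the support,
    because the operator norm is at most the Frobenius norm.  It is therefore
    enough to find a polynomial f of degree at most t with f <= 0 on [0, a] and
    with positive Haar integral.

    We take f(x) = K(x)^(4 d^2 + 1) (x - a), where K is the normalised Fejer
    kernel of order m in the variable 2 x - 1, with m about (5/2) sqrt d / eps;
    K is at least 4/5 when m^2 (1 - x) <= 3/5 and at most 1 / (m^2 (1 - x))
    everywhere.  No volume estimate on U(d) is needed to see that the positive
    part of f wins.  Normalise the phase of U^* V so that its trace is
    nonnegative and cut the 2 d^2 real coordinates of the result into cubes.
    By invariance every cube has measure at most that of the cap
    m^2 (1 - x) <= 3/5, and by AM-GM the bound for K^(4 d^2) on the cube of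
    index z factorises as a product over the coordinates, so the sum over all
    cubes is the (2 d^2)-th power of one numerical series. *)

Require Import Defs.
From HB Require Import structures.
From mathcomp Require Import all_boot all_order all_algebra.
From mathcomp Require Import all_classical all_reals all_analysis.
From mathcomp.real_closed Require Import complex mxtens.
From mathcomp Require Import measurable_realfun ring lra.
Import Order.TTheory GRing.Theory Num.Theory.
Local Open Scope classical_set_scope.
Local Open Scope ring_scope.

(** * The Fejer kernel *)

Section Fejer.
Context {R : realType}.
Implicit Types (x w phi : R) (m : nat).

(** [(fejer m).[x]] is (1 - T_m(z)) / (1 - z) with z = 2 x - 1 and T_m the Chebyshev polynomial. *)
Fixpoint fejer m : {poly R} :=
  if m is m1.+1 then
    if m1 is m2.+1 then (2%:P * (2%:P * 'X - 1)) * fejer m1 - fejer m2 + 2%:P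
    else 1
  else 0.

Lemma fejerSS m :
  fejer m.+2 = (2%:P * (2%:P * 'X - 1)) * fejer m.+1 - fejer m + 2%:P.
Proof. by []. Qed.

Lemma size_fejer m : (size (fejer m) <= m)%N.
Proof.
suff: (size (fejer m) <= m)%N /\ (size (fejer m.+1) <= m.+1)%N by case.
elim: m => [|m [IH0 IH1]]; first by rewrite size_poly0 size_poly1.
split=> //; rewrite fejerSS.
apply: leq_trans (size_polyD _ _) _; rewrite geq_max; apply/andP; split; last first.
  by apply: leq_trans (size_polyC_leq1 _) _.
apply: leq_trans (size_polyD _ _) _; rewrite geq_max size_polyN; apply/andP; split; last first.
  by apply: leq_trans IH0 _; rewrite ltnW.
apply: leq_trans (size_polyMleq _ _) _.
have s2 : (size (2%:P * (2%:P * 'X - 1) : {poly R})%R <= 2)%N.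
  rewrite mul_polyC; apply: leq_trans (size_scale_leq _ _) _.
  apply: leq_trans (size_polyD _ _) _; rewrite geq_max size_polyN size_poly1 andbT.
  by rewrite mul_polyC; apply: leq_trans (size_scale_leq _ _) _; rewrite size_polyX.
by rewrite -subn1 leq_subLR add1n; apply: leq_trans (leq_add s2 IH1) _; rewrite add2n.
Qed.

Lemma horner_fejerSS m x :
  (fejer m.+2).[x] = 2 * (2 * x - 1) * (fejer m.+1).[x] - (fejer m).[x] + 2.
Proof. by rewrite fejerSS !hornerE. Qed.

(** The recurrence of [fejer] encodes cos((m+2) phi) + cos(m phi) = 2 cos(phi) cos((m+1) phi), hence
    the induction on two consecutive indices. At x = 1 the identity reads 0 = 0, so [fejer_at_1]
    treats that endpoint. *)
Lemma fejer_cos m x phi : cos phi = 2 * x - 1 ->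
  2 * (1 - x) * (fejer m).[x] = 1 - cos (m%:R * phi).
Proof.
move=> cphi.
suff: 2 * (1 - x) * (fejer m).[x] = 1 - cos (m%:R * phi) /\
  2 * (1 - x) * (fejer m.+1).[x] = 1 - cos (m.+1%:R * phi) by case.
elim: m => [|m [IH0 IH1]].
  by rewrite /= horner0 !hornerE ?mul0r ?mul1r cos0 cphi; split; ring.
split=> //; rewrite horner_fejerSS.
have -> : m.+2%:R * phi = m.+1%:R * phi + phi by rewrite -(natr1 m.+1); ring.
have E : m%:R * phi = m.+1%:R * phi - phi by rewrite -(natr1 m); ring.
rewrite E cosB in IH0; rewrite cosD cphi; rewrite cphi in IH0.
by nra.
Qed.

Lemma normr_sin_mul_le m phi : `|sin (m%:R * phi)| <= m%:R * `|sin phi|.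
Proof.
elim: m => [|m IH]; first by rewrite !mul0r sin0 normr0.
rewrite -natr1 mulrDl mul1r sinD.
apply: le_trans (ler_normD _ _) _; rewrite !normrM mulrDl mul1r; apply: lerD.
  apply: le_trans IH; rewrite ler_piMr //.
  by rewrite ler_norml cos_geN1 cos_le1.
by rewrite ler_piMl // ler_norml cos_geN1 cos_le1.
Qed.

(** By 1 - cos a = 2 sin(a/2)^2 this is the square of [normr_sin_mul_le] at phi / 2. *)
Lemma one_sub_cos_mul_le m phi : 1 - cos (m%:R * phi) <= m%:R ^+ 2 * (1 - cos phi).
Proof.
have E a : 1 - cos a = 2 * `|sin (a / 2)| ^+ 2 :> R.
  rewrite {1}(splitr a) cosD real_normK ?num_real //.
  by rewrite -!expr2 cos2sin2; ring.
rewrite (E (m%:R * phi)) (E phi) [leRHS]mulrCA ler_pM2l // -exprMn ler_pXn2r ?nnegrE ?mulr_ge0 //.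
by rewrite -mulrA normr_sin_mul_le.
Qed.

Lemma cos_affine_surj x : 0 <= x <= 1 -> exists phi, cos phi = 2 * x - 1.
Proof.
by move=> x01; exists (acos (2 * x - 1)); rewrite acosK // in_itv /=; apply/andP; split; lra.
Qed.

Lemma fejer_at_1 m : (fejer m).[1] = m%:R ^+ 2.
Proof.
suff: (fejer m).[1] = m%:R ^+ 2 /\ (fejer m.+1).[1] = m.+1%:R ^+ 2 by case.
elim: m => [|m [IH0 IH1]]; first by rewrite /= horner0 hornerC expr0n expr1n.
by split=> //; rewrite horner_fejerSS IH0 IH1 -(natr1 m.+1) -(natr1 m); ring.
Qed.

Lemma fejer_ge0 m x : 0 <= x <= 1 -> 0 <= (fejer m).[x].
Proof.
move=> /[dup] x01 /andP[x0]; rewrite le_eqVlt => /orP[/eqP -> | x1]; first by rewrite fejer_at_1 sqr_ge0.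
have [phi cphi] := @cos_affine_surj x x01.
have := @fejer_cos m x phi cphi.
have := cos_le1 (m%:R * phi); set F := _.[x]; nra.
Qed.

Lemma fejer_decay m x : 0 <= x <= 1 -> (1 - x) * (fejer m).[x] <= 1.
Proof.
move=> /[dup] x01 /andP[x0]; rewrite le_eqVlt => /orP[/eqP -> | x1]; first by rewrite subrr mul0r.
have [phi cphi] := @cos_affine_surj x x01.
have := @fejer_cos m x phi cphi.
have := cos_geN1 (m%:R * phi); set F := _.[x]; nra.
Qed.

Lemma fejer_le_sq m x : 0 <= x <= 1 -> (fejer m).[x] <= m%:R ^+ 2.
Proof.
move=> /[dup] x01 /andP[x0]; rewrite le_eqVlt => /orP[/eqP -> | x1]; first by rewrite fejer_at_1.
have [phi cphi] := @cos_affine_surj x x01.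
have := @fejer_cos m x phi cphi.
have := one_sub_cos_mul_le m phi; rewrite cphi => + E; rewrite -E.
have -> : 1 - (2 * x - 1) = 2 * (1 - x) by ring.
by rewrite mulrC ler_pM2r //; lra.
Qed.

(** Comparison with the tangent [g] of the kernel at x = 1, whose slope is m^2 (m^2 - 1) / 3. The
    error [e] vanishes at m = 0 and m = 1 and is convex in m by [fejer_le_sq], so it is nonnegative
    and nondecreasing. *)
Lemma fejer_ge m x : 0 <= x <= 1 ->
  m%:R ^+ 2 * (1 - m%:R ^+ 2 * (1 - x) / 3) <= (fejer m).[x].
Proof.
move=> /[dup] x01 /andP[x0 x1].
(* The second difference of [e] below is [4 * (1 - x) * (m ^ 2 - fejer m)], which is nonnegative. *)
pose g k : R := k%:R ^+ 2 - (1 - x) * k%:R ^+ 2 * (k%:R ^+ 2 - 1) / 3.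
suff : g m <= (fejer m).[x].
  apply: le_trans; rewrite /g; have := sqr_ge0 (m%:R : R); set a := _ ^+ 2 => a0.
  have : 0 <= (1 - x) * a by rewrite mulr_ge0 // subr_ge0.
  by nra.
pose e k := (fejer k).[x] - g k.
suff : 0 <= e m /\ e m <= e m.+1 by rewrite subr_ge0 => -[].
elim: m => [|m [e0 e1]].
  have -> : e 0%N = 0 by rewrite /e /g /= horner0; lra.
  have -> : e 1%N = 0 by rewrite /e /g /= hornerC; lra.
  by [].
split; first exact: le_trans e1.
have := @fejer_le_sq m.+1 x x01.
move: e1; rewrite /e horner_fejerSS /g -(natr1 m.+1) -(natr1 m).
set F0 := (fejer m).[x]; set F1 := (fejer _).[x]; set a := m%:R => e1 F1le.
have : 0 <= (1 - x) * ((a + 1) ^+ 2 - F1) by rewrite mulr_ge0 // subr_ge0.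
move: e1; rewrite -subr_ge0 => e1 h; rewrite -subr_ge0.
(* The second difference is 4 times the quantity in [h], hence the four copies. *)
apply: le_trans (addr_ge0 e1 (addr_ge0 h (addr_ge0 h (addr_ge0 h h)))) _.
by rewrite le_eqVlt; apply/orP; left; apply/eqP; field.
Qed.

End Fejer.

(** * Numerical bounds *)

(** The first ten terms are evaluated exactly. The later ones are at most (x + 1)^-4, which is
    dominated by the telescoping difference of 1 / (3 x^3). *)
Lemma sum_inv_quartic_le {R : realFieldType} (M : nat) :
  \sum_(z < M) (26 + z%:R ^+ 2 : R) ^- 2 <= 9 / 1250.
Proof.
have base : \sum_(z < 10) (26 + z%:R ^+ 2 : R) ^- 2 <= 9 / 1250 - (3 * 9 ^+ 3)^-1.
  rewrite !big_ord_recr big_ord0 /=.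
  have -> : (26 + 0 ^+ 2) ^- 2 = 1 / 676 :> R by field.
  have -> : (26 + 1 ^+ 2) ^- 2 = 1 / 729 :> R by field.
  have -> : (26 + 2 ^+ 2) ^- 2 = 1 / 900 :> R by field.
  have -> : (26 + 3 ^+ 2) ^- 2 = 1 / 1225 :> R by field.
  have -> : (26 + 4 ^+ 2) ^- 2 = 1 / 1764 :> R by field.
  have -> : (26 + 5 ^+ 2) ^- 2 = 1 / 2601 :> R by field.
  have -> : (26 + 6 ^+ 2) ^- 2 = 1 / 3844 :> R by field.
  have -> : (26 + 7 ^+ 2) ^- 2 = 1 / 5625 :> R by field.
  have -> : (26 + 8 ^+ 2) ^- 2 = 1 / 8100 :> R by field.
  have -> : (26 + 9 ^+ 2) ^- 2 = 1 / 11449 :> R by field.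
  have -> : (3 * 9 ^+ 3)^-1 = 1 / 2187 :> R by field.
  lra.
have step (x : R) : 9 <= x ->
    (26 + (x + 1) ^+ 2) ^- 2 <= (3 * x ^+ 3)^-1 - (3 * (x + 1) ^+ 3)^-1.
  move=> x9; have x0 : 0 < x by lra.
  have -> : (3 * x ^+ 3)^-1 - (3 * (x + 1) ^+ 3)^-1 =
      (3 * x ^+ 2 + 3 * x + 1) / (3 * x ^+ 3 * (x + 1) ^+ 3).
    by field; rewrite !gt_eqF //; lra.
  apply: (@le_trans _ _ ((x + 1) ^- 4)).
    rewrite lef_pV2 ?posrE ?exprn_gt0 ?addr_gt0 ?exprn_gt0 ?addr_gt0 //.
    have := sqr_ge0 (x + 1); nra.
  rewrite ler_pdivlMr ?mulr_gt0 ?exprn_gt0 ?addr_gt0 //.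
  rewrite [leLHS](_ : _ = 3 * x ^+ 3 / (x + 1)); last by field; rewrite gt_eqF //; lra.
  by rewrite ler_pdivrMr; nra.
have key n : \sum_(z < n + 10) (26 + z%:R ^+ 2 : R) ^- 2 <= 9 / 1250 - (3 * (n%:R + 9) ^+ 3)^-1.
  elim: n => [|n IH]; first by rewrite add0n add0r.
  rewrite addSn big_ord_recr /=.
  have := @step (n%:R + 9); rewrite lerDr ler0n => /(_ isT).
  rewrite (_ : (n + 10)%:R = n%:R + 9 + 1); last by rewrite natrD; ring.
  rewrite (_ : n.+1%:R + 9 = n%:R + 9 + 1); last by rewrite -natr1; ring.
  by move: IH; set S := \sum_(_ < _) _; lra.
(* Ten nonnegative terms are added so that [key] also covers M < 10. *)
apply: (@le_trans _ _ (\sum_(z < M + 10) (26 + z%:R ^+ 2 : R) ^- 2)).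
  rewrite big_split_ord /= lerDl; apply: sumr_ge0 => i _.
  by rewrite invr_ge0 exprn_ge0 // addr_ge0 ?sqr_ge0.
by apply: le_trans (key M) _; rewrite gerBl invr_ge0 mulr_ge0.
Qed.

(** Since exp(-1/24) >= 23/24, exp(1/24) <= 24/23; logarithms are thus bounded below by comparing
    rational powers. *)
Lemma ln_ge_of_expn {R : realType} (x : R) (k : nat) :
  (24 / 23) ^+ k <= x -> k%:R / 24 <= ln x.
Proof.
move=> h; have x0 : 0 < x by apply: lt_le_trans h; rewrite exprn_gt0.
rewrite -ler_expR lnK ?posrE //; apply: le_trans h.
have -> : k%:R / 24 = k%:R * 24^-1 :> R by [].
rewrite expRM_natl lerXn2r ?nnegrE ?expR_ge0 //.
rewrite -[expR _]invrK -expRN -[leRHS]invrK lef_pV2 ?posrE ?invr_gt0 ?expR_gt0 //.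
have := @expR_ge1Dx R (- 24^-1); apply: le_trans.
by rewrite invf_div; lra.
Qed.

Lemma pow_24_23_32 {R : realFieldType} : (24 / 23 : R) ^+ 32 <= 397 / 100.
Proof.
have sq (x y z : R) : 0 <= x -> x <= y -> y ^+ 2 <= z -> x ^+ 2 <= z.
  by move=> x0 xy; apply: le_trans; rewrite lerXn2r ?nnegrE // (le_trans x0).
have q8 : (24 / 23 : R) ^+ 8 <= 141 / 100 by lra.
have q8_ge0 : 0 <= (24 / 23 : R) ^+ 8 by apply: exprn_ge0.
rewrite (exprM _ 8 4) (exprM _ 2 2); move: q8 q8_ge0; move: (_ ^+ 8) => x x1 x0.
have q16 : x ^+ 2 <= 199 / 100 by apply: sq x0 x1 _; lra.
by apply: sq q16 _; [apply: exprn_ge0|lra].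
Qed.

Lemma tau_ge {R : realType} (eps : R) (d : nat) :
  (2 <= d)%N -> 0 < eps <= 1 -> 11 <= 5 * tau eps d.
Proof.
move=> d2 /andP[e0 e1]; rewrite /tau; set L := Num.sqrt (ln _).
have d2R : 2 <= d%:R :> R by rewrite ler_nat.
have pi2 := @pi_ge2 R.
have p32 := @pow_24_23_32 R.
have L2 : 397 / 200 <= L.
  (* As pi >= 2, the argument of ln is at least 60, while (24/23)^95 <= 3.97^3 * 23/24 < 60.
     Moreover 95/24 exceeds (397/200)^2. *)
  have L0 : 95%:R / 24 <= ln (6 * (5 * pi) / eps).
    apply: ln_ge_of_expn.
    apply: (@le_trans _ _ 60); last by rewrite ler_pdivlMr //; nra.
    have q0 : 0 < (24 / 23 : R) ^+ 32 by apply: exprn_gt0.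
    have -> : 95%N = (32 + (32 + 31))%N by [].
    rewrite !exprD (_ : (24 / 23) ^+ 31 = (24 / 23) ^+ 32 * (23 / 24)); last first.
      by rewrite [in RHS]exprSr -mulrA (_ : 24 / 23 * (23 / 24) = 1) ?mulr1 //; field.
    move: p32 q0; move: (_ ^+ 32) => q q1 /ltW q0.
    have q2 : q * q <= (397 / 100) ^+ 2 by apply: ler_pM => //; exact: q0.
    have : q * (q * q) <= 397 / 100 * (397 / 100) ^+ 2.
      by apply: ler_pM => //; apply: mulr_ge0.
    lra.
  rewrite /L -[leLHS]ger0_norm; last by lra.
  by rewrite -sqrtr_sqr; apply: ler_wsqrtr; lra.
(* Here d L / eps >= 2 * 397/200, which is exactly the bound of [pow_24_23_32]. *)
have l4 : 4 / 3 <= ln (d%:R / eps * L).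
  have -> : 4 / 3 = 32%:R / 24 :> R by lra.
  apply: ln_ge_of_expn; apply: le_trans p32 _.
  rewrite mulrAC ler_pdivlMr //; nra.
have s : 115 / 100 <= Num.sqrt (L / 32 + ln (d%:R / eps * L)).
  rewrite -[leLHS]ger0_norm; last by lra.
  by rewrite -sqrtr_sqr; apply: ler_wsqrtr; lra.
move: s; set S := Num.sqrt _ => s; nra.
Qed.

Lemma ceil_nat {R : realType} (x : R) : 0 <= x -> exists m : nat, x <= m.+1%:R /\ m%:R <= x.
Proof.
move=> x0; exists (Num.truncn x); split; first by rewrite ltW // truncnS_gt.
by rewrite truncn_le.
Qed.

Lemma powR_five_halves {R : realType} (x : R) : 0 <= x -> x `^ (5 / 2) = x ^+ 2 * Num.sqrt x.
Proof.
rewrite le_eqVlt => /orP[/eqP <-|x0].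
  by rewrite powR0 ?expr0n ?mul0r.
rewrite -powR12_sqrt ?ltW // -powR_mulrn ?ltW // -powRD ?gt_eqF ?implybT //.
by congr (_ `^ _); lra.
Qed.

(** The kernel [fejer m.+1] has degree at most m, so the test polynomial has degree at most (4 d^2 +
    1) m + 1. Rounding (5/2) sqrt d / eps down gives m for this count, while m + 1 is large enough
    for the first bound. *)
Lemma exists_fejer_degree {R : realType} (eps : R) (d t : nat) :
  (2 <= d)%N -> 0 < eps <= 1 ->
  5 * (d%:R `^ (5 / 2)) / eps * tau eps d <= t%:R ->
  exists m : nat, 25 * d%:R / (4 * eps ^+ 2) <= m.+1%:R ^+ 2 :> R /\
    ((4 * d ^ 2 + 1) * m + 1 <= t)%N.
Proof.
move=> d2 e01; have T := @tau_ge R eps d d2 e01; case/andP: e01 => e0 e1.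
rewrite powR_five_halves //.
have d2R : 2 <= d%:R :> R by rewrite ler_nat.
set D := d%:R : R in d2R *; set s := Num.sqrt D.
have ss : s ^+ 2 = D by rewrite sqr_sqrtr //; lra.
have s75 : 7 / 5 <= s.
  rewrite -[leLHS]ger0_norm // -sqrtr_sqr ler_wsqrtr //; lra.
have s0 : 1 <= s by rewrite -sqrtr1 ler_wsqrtr //; lra.
pose u := s / eps.
have u1 : s <= u by rewrite ler_pdivlMr //; nra.
have -> : 5 * (D ^+ 2 * s) / eps * tau eps d = D ^+ 2 * u * (5 * tau eps d) by rewrite /u; ring.
move=> ht.
have [|m [m1 m2]] := @ceil_nat R (5 / 2 * u); first by lra.
exists m; split.
  have -> : 25 * D / (4 * eps ^+ 2) = (5 / 2 * u) ^+ 2.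
    by rewrite /u -ss; field; rewrite gt_eqF.
  rewrite ler_sqr ?nnegrE //; lra.
rewrite -(ler_nat R) natrD natrM natrD natrM natrX -/D.
apply: le_trans ht.
have D4 : 4 <= D ^+ 2 by nra.
have Du : 5 <= D ^+ 2 * u.
  have u75 : 7 / 5 <= u by apply: le_trans u1.
  by apply: (@le_trans _ _ (4 * u)); [lra | rewrite ler_pM2r //; lra].
have a1 : D ^+ 2 * u * 11 <= D ^+ 2 * u * (5 * tau eps d) by rewrite ler_pM2l //; lra.
apply: le_trans a1.
have : (4 * D ^+ 2 + 1) * m%:R <= (4 * D ^+ 2 + 1) * (5 / 2 * u).
  by rewrite ler_pM2l //; lra.
(* The degree is at most 10 D^2 u + (5/2) u + 1. Since D^2 >= 4 and D^2 u >= 5, the last two terms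
   fit into one more D^2 u, giving the factor 11 of [tau_ge]. *)
have : 1 <= D ^+ 2 / 4 by lra.
have : 0 <= u * (D ^+ 2 / 4 - 1) by rewrite mulr_ge0 //; lra.
lra.
Qed.

(** * Fidelity of unitary matrices *)

(** Absolute values are rounded down, so that the index bounds |f| from below. This merges the two
    intervals next to 0, and the boolean records the sign to separate them. *)
Lemma grid_code {R : realType} (T : Type) (I : finType) (f : T -> I -> R) (B g : R) :
  0 < g -> (forall x i, `|f x i| <= B) ->
  exists M (code : T -> {ffun I -> 'I_M * bool}),
    (forall x i, (code x i).1%:R * g <= `|f x i|) /\
    (forall x y, code x = code y -> forall i, `|f x i - f y i| <= g).
Proof.
move=> g0 fB; pose M := (Num.truncn (B / g)).+1.
pose k x i := Num.truncn (`|f x i| / g).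
have kM x i : (k x i < M)%N.
  by rewrite ltnS; apply: le_truncn; rewrite ler_pM2r ?invr_gt0.
exists M, (fun x => [ffun i => (Ordinal (kM x i), f x i < 0)]).
have kP x i : (k x i)%:R * g <= `|f x i| < ((k x i).+1)%:R * g.
  have q0 : 0 <= `|f x i| / g by rewrite divr_ge0 // ltW.
  by rewrite /k -ler_pdivlMr // -ltr_pdivrMr // truncn_le q0 truncnS_gt.
split=> [x i|x y /ffunP e i]; first by rewrite ffunE /=; case/andP: (kP x i).
have := e i; rewrite !ffunE => -[ek es].
have := kP x i; have := kP y i; rewrite -ek -natr1.
move: es; case: (ltP (f x i) 0) => fx; case: (ltP (f y i) 0) => fy //= _.
- rewrite (ltr0_norm fx) (ltr0_norm fy) => /andP[? ?] /andP[? ?].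
  by rewrite ler_norml; apply/andP; split; lra.
- rewrite (ger0_norm fx) (ger0_norm fy) => /andP[? ?] /andP[? ?].
  by rewrite ler_norml; apply/andP; split; lra.
Qed.

Section ComplexMatrices.
Context {R : realType}.
Implicit Types (z : R[i]).

Definition sqn z : R := complex.Re z ^+ 2 + complex.Im z ^+ 2.

Lemma sqn_ge0 z : 0 <= sqn z.
Proof. by rewrite addr_ge0 ?sqr_ge0. Qed.

Lemma sqnM z1 z2 : sqn (z1 * z2) = sqn z1 * sqn z2.
Proof. by case: z1 z2 => [a b] [c e]; rewrite /sqn /=; ring. Qed.

Lemma sqn_conj z : sqn (conjc z) = sqn z.
Proof. by case: z => a b; rewrite /sqn /= sqrrN. Qed.

Lemma mulc_conj z : conjc z * z = (sqn z)%:C%C.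
Proof. by case: z => a b; rewrite /sqn; simpc; congr (_ +i* _)%C; ring. Qed.

Lemma Re_sum (I : finType) (F : I -> R[i]) :
  complex.Re (\sum_i F i) = \sum_i complex.Re (F i).
Proof. by apply: (big_morph _ (id1 := 0)) => // -[a b] [c e]. Qed.

Lemma Im_sum (I : finType) (F : I -> R[i]) :
  complex.Im (\sum_i F i) = \sum_i complex.Im (F i).
Proof. by apply: (big_morph _ (id1 := 0)) => // -[a b] [c e]. Qed.

Lemma Re_le_sqrt_sqn z : complex.Re z <= Num.sqrt (sqn z).
Proof.
apply: le_trans (ler_norm _) _; rewrite -sqrtr_sqr ler_wsqrtr //.
by rewrite lerDl sqr_ge0.
Qed.

Lemma real_cauchy_schwarz (I : finType) (a b : I -> R) :
  (\sum_i a i * b i) ^+ 2 <= (\sum_i a i ^+ 2) * (\sum_i b i ^+ 2).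
Proof.
have : 0 <= \sum_i \sum_j (a i * b j - a j * b i) ^+ 2.
  by apply: sumr_ge0 => i _; apply: sumr_ge0 => j _; apply: sqr_ge0.
have -> : \sum_i \sum_j (a i * b j - a j * b i) ^+ 2 =
   \sum_i \sum_j (a i ^+ 2 * b j ^+ 2 + b i ^+ 2 * a j ^+ 2
     + (- 2) * ((a i * b i) * (a j * b j))).
  by apply: eq_bigr => i _; apply: eq_bigr => j _; ring.
under eq_bigr do rewrite !big_split /= -!mulr_sumr.
rewrite !big_split /= -!mulr_suml -mulr_sumr -mulr_suml.
set A := \sum_i a i ^+ 2; set B := \sum_i b i ^+ 2; set C := \sum_i a i * b i.
rewrite expr2; nra.
Qed.

Lemma sqn_sum_le (I : finType) (a b : I -> R[i]) :
  sqn (\sum_i a i * b i) <= (\sum_i sqn (a i)) * (\sum_i sqn (b i)).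
Proof.
have sqnE z : sqn z = Normc.normc z ^+ 2.
  by case: z => x y; rewrite /sqn sqr_sqrtr //= addr_ge0 ?sqr_ge0.
have -> : \sum_i sqn (a i) = \sum_i Normc.normc (a i) ^+ 2 by apply: eq_bigr.
have -> : \sum_i sqn (b i) = \sum_i Normc.normc (b i) ^+ 2 by apply: eq_bigr.
apply: (@le_trans _ _ ((\sum_i Normc.normc (a i) * Normc.normc (b i)) ^+ 2)); last first.
  exact: real_cauchy_schwarz.
rewrite sqnE.
have n0 z : 0 <= Normc.normc z by case: z => x y; apply: sqrtr_ge0.
have S0 : 0 <= \sum_i Normc.normc (a i) * Normc.normc (b i).
  by apply: sumr_ge0 => i _; apply: mulr_ge0.
apply: lerXn2r; rewrite ?nnegrE //.
elim/big_ind2 : _ => [||i _]; first by rewrite Normc.normc0.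
  by move=> x1 x2 y1 y2 h1 h2; apply: le_trans (le_normcD _ _) _; apply: lerD.
by rewrite Normc.normcM.
Qed.

Section Square.
Context {d : nat}.
Implicit Types (A B : 'M[R[i]]_d) (U V W : unitary_mx R d).

Definition frob2 A : R := \sum_i \sum_j sqn (A i j).

Lemma frob2_ge0 A : 0 <= frob2 A.
Proof. by apply: sumr_ge0 => i _; apply: sumr_ge0 => j _; apply: sqn_ge0. Qed.

Lemma vnorm_mulmx_le A (v : 'cV[R[i]]_d) :
  vnorm (A *m v) <= Num.sqrt (frob2 A) * vnorm v.
Proof.
rewrite -sqrtrM ?frob2_ge0 // ler_wsqrtr // mulr_suml; apply: ler_sum => k _.
by rewrite mxE; apply: sqn_sum_le.
Qed.

Lemma vnorm_delta (j : 'I_d) : vnorm (delta_mx j 0 : 'cV[R[i]]_d) = 1.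
Proof.
rewrite /vnorm (bigD1 j) //= big1 ?addr0; last first.
  by move=> k kj; rewrite mxE (negbTE kj) /= expr0n addr0.
by rewrite mxE !eqxx /= expr1n expr0n addr0 sqrtr1.
Qed.

Lemma opnorm_ub A : ubound [set vnorm (A *m v) | v in [set v : 'cV[R[i]]_d | vnorm v = 1]]
  (Num.sqrt (frob2 A)).
Proof. by move=> _ [v /= v1 <-]; rewrite -[leRHS]mulr1 -v1 vnorm_mulmx_le. Qed.

Lemma opnorm_le_frob A : opnorm A <= Num.sqrt (frob2 A).
Proof.
rewrite /opnorm; set S := (X in sup X).
(* For d = 0 there is no unit vector, and the supremum of the empty set is 0. *)
have [->|/set0P S0] := eqVneq S set0; first by rewrite sup0 sqrtr_ge0.
exact: ge_sup (opnorm_ub A).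
Qed.

Lemma opnorm_ge0 A : 0 <= opnorm A.
Proof.
rewrite /opnorm; set S := (X in sup X).
have [->|/set0P [x Sx]] := eqVneq S set0; first by rewrite sup0.
apply: (@le_trans _ _ x); first by case: Sx => v _ <-; apply: sqrtr_ge0.
by apply: ub_le_sup => //; exists (Num.sqrt (frob2 A)); apply: opnorm_ub.
Qed.

Lemma sqn_le_opnorm A i j : sqn (A i j) <= opnorm A ^+ 2.
Proof.
have h : vnorm (A *m delta_mx j (0 : 'I_1)) <= opnorm A.
  apply: ub_le_sup; first by exists (Num.sqrt (frob2 A)); apply: opnorm_ub.
  by exists (delta_mx j 0) => //=; apply: vnorm_delta.
have v0 : 0 <= vnorm (A *m delta_mx j (0 : 'I_1)) by apply: sqrtr_ge0.
apply: (@le_trans _ _ (vnorm (A *m delta_mx j (0 : 'I_1)) ^+ 2)); last first.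
  by rewrite lerXn2r ?nnegrE // (le_trans v0).
rewrite -colE sqr_sqrtr; last by apply: sumr_ge0 => k _; apply: sqn_ge0.
rewrite (bigD1 i) //= mxE lerDl; apply: sumr_ge0 => k _; exact: sqn_ge0.
Qed.

Lemma adjmxM A B : adjmx (A *m B) = adjmx B *m adjmx A.
Proof. by rewrite /adjmx trmx_mul map_mxM. Qed.

Lemma adjmxK A : adjmx (adjmx A) = A.
Proof. by apply/matrixP => i j; rewrite !mxE conjcK. Qed.

Lemma mul_umx_adj U : umx U *m adjmx U = 1%:M.
Proof. by apply/eqP; exact: umxP U. Qed.

Lemma mul_adj_umx U : adjmx U *m umx U = 1%:M.
Proof. exact: mulmx1C (mul_umx_adj U). Qed.

Lemma is_unitary_adj U : Defs.is_unitary (adjmx U).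
Proof. by rewrite /Defs.is_unitary adjmxK mul_adj_umx. Qed.

Lemma is_unitaryM U V : Defs.is_unitary (umx U *m umx V).
Proof.
by rewrite /Defs.is_unitary adjmxM mulmxA -(mulmxA (umx U)) mul_umx_adj mulmx1 mul_umx_adj.
Qed.

Definition uadj U := Unitary (is_unitary_adj U).
Definition umul U V := Unitary (is_unitaryM U V).

Lemma frob2_trace A : frob2 A = complex.Re (\tr (adjmx A *m A)).
Proof.
rewrite /frob2 /mxtrace Re_sum exchange_big /=; apply: eq_bigr => i _.
by rewrite mxE Re_sum; apply: eq_bigr => j _; rewrite !mxE mulc_conj.
Qed.

Definition inner U V : R[i] := \tr (adjmx U *m umx V).

(** The square root of the fidelity |tr (U^* V)| ^ 2 / d ^ 2. *)
Definition fid U V : R := Num.sqrt (sqn (inner U V)) / d%:R.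

Lemma inner_conj U V : inner V U = conjc (inner U V).
Proof.
rewrite /inner /mxtrace rmorph_sum; apply: eq_bigr => i _; rewrite !mxE rmorph_sum.
apply: eq_bigr => j _; rewrite !mxE /=.
by case: (umx V j i) => a b; case: (umx U j i) => c e; simpc; congr (_ +i* _)%C; ring.
Qed.

Lemma frob2_sub U V (z1 z2 : R[i]) : sqn z1 = 1 -> sqn z2 = 1 ->
  frob2 (z1 *: umx U - z2 *: umx V) = 2 * d%:R - 2 * complex.Re (conjc z1 * z2 * inner U V).
Proof.
move=> s1 s2; rewrite frob2_trace.
have -> : adjmx (z1 *: umx U - z2 *: umx V) = conjc z1 *: adjmx U - conjc z2 *: adjmx V.
  by apply/matrixP => i j; rewrite !mxE rmorphB !rmorphM.
have cs z : sqn z = 1 -> conjc z * z = 1 by rewrite mulc_conj => ->.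
rewrite mulmxBl !mulmxBr -!scalemxAl -!scalemxAr !scalerA !mul_adj_umx !cs // !scale1r.
have trB A B : \tr (A - B) = \tr A - \tr B by apply: raddfB.
rewrite !trB !mxtraceZ mxtrace1 -/(inner U V) -/(inner V U).
have -> : conjc z2 * z1 * inner V U = conjc (conjc z1 * z2 * inner U V).
  rewrite !rmorphM /= conjcK; congr (_ * _); first by rewrite mulrC.
  exact: inner_conj.
set w := conjc z1 * z2 * _; case: w => a b.
have -> : (d%:R : R[i]) = d%:R%:C%C by rewrite rmorph_nat.
by rewrite /=; ring.
Qed.

Lemma polar (z : R[i]) : sqn z = 1 -> exists2 phi, phi \in `[0, 2 * pi[ & z = phase phi.
Proof.
case: z => a b; rewrite /sqn /= => ab1.
have a11 : -1 <= a <= 1.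
  have := sqr_ge0 b; rewrite -ler_norml -(@ler_sqr _ `|a|) ?nnegrE //.
  by rewrite real_normK ?num_real //; lra.
have ain : a \in `[(-1), 1] by rewrite in_itv.
have sE : sin (acos a) = `|b|.
  by rewrite sin_acos // -ab1 addrC addKr sqrtr_sqr.
have pi0 := @pi_gt0 R.
have [b0|b0] := leP 0 b.
  exists (acos a); last by rewrite /phase acosK // sE ger0_norm.
  rewrite in_itv /= acos_ge0 //=; have := acos_lepi a11; lra.
exists (2 * pi - acos a).
  rewrite in_itv /=; apply/andP; split; first by have := acos_lepi a11; lra.
  have : 0 < acos a; last by lra.
  rewrite acos_gt0 //; case/andP: a11 => -> a1 /=.
  by rewrite lt_neqAle a1 andbT; apply/eqP => a1E; move: ab1 b0; rewrite a1E; nra.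
have -> : 2 * pi - acos a = - acos a + pi *+ 2 by rewrite -mulr_natl; ring.
rewrite /phase cosD2pi sinD2pi cosN sinN acosK // sE ltr0_norm //.
by rewrite opprK.
Qed.

Lemma sqn_phase phi : sqn (phase phi : R[i]) = 1.
Proof. by rewrite /sqn /= cos2Dsin2. Qed.

Lemma align (z : R[i]) : exists2 phi, phi \in `[0, 2 * pi[ &
  phase phi * z = (Num.sqrt (sqn z))%:C%C.
Proof.
have [->|z0] := eqVneq z 0.
  exists 0; first by rewrite in_itv /= lexx mulr_gt0 ?pi_gt0.
  by rewrite mulr0 /sqn /= expr0n addr0 sqrtr0.
have n0 : 0 < sqn z.
  rewrite lt_neqAle sqn_ge0 andbT eq_sym paddr_eq0 ?sqr_ge0 // !sqrf_eq0.
  by move: z0; rewrite eq_complex.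
set s := Num.sqrt (sqn z); have s0 : 0 < s by rewrite sqrtr_gt0.
have sC0 : s%:C%C != 0 by rewrite (inj_eq (@complexI R) s 0) gt_eqF.
have ss : s ^+ 2 = sqn z by rewrite sqr_sqrtr ?ltW.
have u1 : sqn (conjc z * s^-1%:C%C) = 1.
  rewrite sqnM sqn_conj {2}/sqn /= expr0n addr0 exprVn ss divff // gt_eqF //.
have [phi ? phiE] := polar _ u1; exists phi => //.
rewrite -phiE mulrAC mulc_conj -ss -rmorphM /=; congr (_%:C)%C.
by rewrite expr2 mulfK // gt_eqF.
Qed.

Hypothesis d_gt0 : (0 < d)%N.

Lemma sqrt_inner U V : Num.sqrt (sqn (inner U V)) = d%:R * fid U V.
Proof. by rewrite mulrC divfK // pnatr_eq0 -lt0n. Qed.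

Lemma fid_ge0 U V : 0 <= fid U V.
Proof. by rewrite divr_ge0 ?sqrtr_ge0. Qed.

(** With the phase that makes the inner product real and nonnegative, 2 d (1 - fid) is a squared
    Frobenius norm. *)
Lemma fid_le1 U V : fid U V <= 1.
Proof.
have [phi _ e] := align (inner U V).
have : 0 <= frob2 (1 *: umx U - phase phi *: umx V) by apply: frob2_ge0.
rewrite frob2_sub ?sqn_phase //; last by rewrite /sqn /= expr1n expr0n addr0.
rewrite conjc1 mul1r e /= sqrt_inner.
have : 0 < d%:R :> R by rewrite ltr0n.
by move=> ? ?; rewrite -(@ler_pM2l _ d%:R) //; lra.
Qed.

(** The aligning phase is one candidate in the infimum, and for it the operator norm is bounded by
    the Frobenius norm. *)
Lemma Dch_le U V : Dch (umx U) (umx V) <= Num.sqrt (2 * d%:R * (1 - fid U V)).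
Proof.
have [phi phi_in e] := align (inner U V).
apply: (@le_trans _ _ (opnorm (umx U - phase phi *: umx V))).
  apply: ge_inf; last by exists phi.
  by exists 0 => _ [psi _ <-]; apply: opnorm_ge0.
apply: le_trans (opnorm_le_frob _) _; rewrite ler_wsqrtr //.
rewrite -[X in frob2 (X - _)]scale1r frob2_sub ?sqn_phase //; last by rewrite /sqn /= expr1n expr0n addr0.
by rewrite conjc1 mul1r e /= sqrt_inner; lra.
Qed.

Lemma frob2_coords A :
  frob2 A = \sum_(c : 'I_d * 'I_d * bool)
    (if c.2 then complex.Re (A c.1.1 c.1.2) else complex.Im (A c.1.1 c.1.2)) ^+ 2.
Proof.
rewrite -(pair_bigA _ (fun (ij : 'I_d * 'I_d) (b : bool) =>
   (if b then complex.Re (A ij.1 ij.2) else complex.Im (A ij.1 ij.2)) ^+ 2)) /=.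
rewrite -(pair_bigA _ (fun i j => \sum_(b : bool)
   (if b then complex.Re (A i j) else complex.Im (A i j)) ^+ 2)) /=.
by apply: eq_bigr => i _; apply: eq_bigr => j _; rewrite big_bool.
Qed.

Lemma coord_sqr_le A (c : 'I_d * 'I_d * bool) :
  (if c.2 then complex.Re (A c.1.1 c.1.2) else complex.Im (A c.1.1 c.1.2)) ^+ 2 <= frob2 A.
Proof.
rewrite frob2_coords (bigD1 c) //= lerDl; apply: sumr_ge0 => ? _; apply: sqr_ge0.
Qed.

Lemma card_coords : #|{: 'I_d * 'I_d * bool}| = (2 * d ^ 2)%N.
Proof. by rewrite !card_prod card_ord card_bool mulnn mulnC. Qed.

(** The coordinates are those of [W - phase * U], with the phase chosen so that
    [phase * tr (W^* U)] is nonnegative. *)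
Lemma normalised_cells W (g : R) : 0 < g ->
  exists M (code : unitary_mx R d -> {ffun 'I_d * 'I_d * bool -> 'I_M * bool}),
    (forall U, (\sum_c (code U c).1%:R ^+ 2) * g ^+ 2 <= 2 * d%:R * (1 - fid W U)) /\
    (forall U V, code U = code V -> 1 - d%:R * g ^+ 2 <= fid U V).
Proof.
move=> g0.
have [ph phP] : exists ph : unitary_mx R d -> R,
    forall U, phase (ph U) * inner W U = (d%:R * fid W U)%:C%C.
  have h U : exists p, phase p * inner W U = (d%:R * fid W U)%:C%C.
    by have [p _ e] := align (inner W U); exists p; rewrite e sqrt_inner.
  by have [ph phP] := boolp.choice h; exists ph.
pose A U : 'M[R[i]]_d := 1 *: umx W - phase (ph U) *: umx U.
pose f U (c : 'I_d * 'I_d * bool) :=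
  if c.2 then complex.Re (A U c.1.1 c.1.2) else complex.Im (A U c.1.1 c.1.2).
have s1 : sqn (1 : R[i]) = 1 by rewrite /sqn /= expr1n expr0n addr0.
have frA U : frob2 (A U) = 2 * d%:R * (1 - fid W U).
  by rewrite frob2_sub ?sqn_phase // conjc1 mul1r phP /=; ring.
have d0 : 0 < d%:R :> R by rewrite ltr0n.
have d1 : 1 <= d%:R :> R by rewrite ler1n.
have fB U c : `|f U c| <= 2 * d%:R.
  rewrite -(@ler_sqr _ `|f U c|) ?nnegrE ?mulr_ge0 // real_normK ?num_real //.
  apply: le_trans (coord_sqr_le _ _) _; rewrite frA.
  have := fid_ge0 W U; nra.
have [M [code [c1 c2]]] := @grid_code _ _ _ f _ g g0 fB.
exists M, code; split => [U|U V /c2 e].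
  rewrite -frA frob2_coords mulr_suml; apply: ler_sum => c _.
  rewrite -exprMn -[leRHS]/(f U c ^+ 2) -[leRHS]real_normK ?num_real //.
  by apply: lerXn2r; rewrite ?nnegrE ?mulr_ge0 ?(ltW g0).
(* The two normalised matrices differ by this one, since W cancels. Each of its 2 d^2 real
   coordinates is at most g in absolute value. By [frob2_sub] this bounds a real part, hence a
   modulus, from below. *)
have : frob2 (phase (ph V) *: umx V - phase (ph U) *: umx U) <= 2 * d%:R ^+ 2 * g ^+ 2.
  rewrite frob2_coords.
  apply: (@le_trans _ _ (\sum_(c : 'I_d * 'I_d * bool) g ^+ 2)).
    apply: ler_sum => c _; have := e c; rewrite -(@ler_sqr _ `|_|) ?nnegrE ?(ltW g0) //.
    rewrite real_normK ?num_real // /f /A; case: c => -[i j] [] /=;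
      rewrite !mxE; move: (1 * _) (phase (ph U) * _) (phase (ph V) * _) => [? ?] [? ?] [? ?] /=;
      apply: le_trans; rewrite le_eqVlt; apply/orP; left; apply/eqP; ring.
  by rewrite sumr_const card_coords -[g ^+ 2 *+ _]mulr_natl natrM natrX.
rewrite frob2_sub ?sqn_phase //.
set w := conjc _ * _ * _.
have sw : sqn w = sqn (inner V U) by rewrite !sqnM sqn_conj !sqn_phase !mul1r.
have := Re_le_sqrt_sqn w; rewrite sw sqrt_inner => h1 h2.
have symm : fid V U = fid U V.
  rewrite /fid -[inner U V]conjcK sqn_conj -inner_conj //.
rewrite -symm -(@ler_pM2l _ d%:R) //; lra.
Qed.

End Square.
End ComplexMatrices.

(** * Functions integrated exactly by a design *)

Section DesignPolynomials.
Context {R : realType} {d : nat}.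
Implicit Types (g : UBorel R d -> R[i]) (t : nat).

(** The restrictions to the unitary group of polynomials homogeneous of degree t in the entries and
    of degree t in their conjugates. *)
Definition gspan t g := exists A : 'M[R[i]]_(d ^ t * d ^ t), forall U, Gfun A U = g U.

Definition conj_umx (U : UBorel R d) : 'M[R[i]]_d := map_mx conjc (val U).

Definition gentry {t} (J I L K : 'I_(d ^ t)) (U : UBorel R d) : R[i] :=
  ntensmx (val U) t J I * ntensmx (conj_umx U) t L K.

Lemma gspan_ext t g1 g2 : g1 =1 g2 -> gspan t g1 -> gspan t g2.
Proof. by move=> e [A hA]; exists A => U; rewrite hA e. Qed.

Lemma gspan_lin t (a : R[i]) g1 g2 :
  gspan t g1 -> gspan t g2 -> gspan t (fun U => a * g1 U + g2 U).
Proof.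
move=> [A hA] [B hB]; exists (a *: A + B) => U.
by rewrite -hA -hB /Gfun mulmxDl raddfD /= -scalemxAl mxtraceZ.
Qed.

Lemma gspan0 t : gspan t (fun=> 0).
Proof. by exists 0 => U; rewrite /Gfun mul0mx raddf0. Qed.

Lemma gspanZ t (a : R[i]) g : gspan t g -> gspan t (fun U => a * g U).
Proof. move=> h; have := gspan_lin _ a _ _ h (gspan0 t).
by apply: gspan_ext => U; rewrite addr0. Qed.

Lemma gspan_sum t (I : finType) (F : I -> UBorel R d -> R[i]) :
  (forall i, gspan t (F i)) -> gspan t (fun U => \sum_i F i U).
Proof.
move=> h; suff: forall s : seq I, gspan t (fun U => \sum_(i <- s) F i U) by apply.
elim=> [|i s IH]; first by apply: gspan_ext (gspan0 t) => U; rewrite big_nil.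
have := gspan_lin _ 1 _ _ (h i) IH.
by apply: gspan_ext => U; rewrite big_cons mul1r.
Qed.

Lemma gspan_entry t (J I L K : 'I_(d ^ t)) : gspan t (gentry J I L K).
Proof.
exists (delta_mx (mxtens_index (I, K)) (mxtens_index (J, L))) => U.
rewrite /Gfun /mxtrace (bigD1 (mxtens_index (I, K))) //= big1 ?addr0.
  rewrite mxE (bigD1 (mxtens_index (J, L))) //= big1 ?addr0.
    by rewrite mxE !eqxx mul1r tensmxE.
  by move=> j jn; rewrite mxE (negbTE jn) andbF mul0r.
by move=> i In; rewrite mxE big1 // => j _; rewrite mxE (negbTE In) mul0r.
Qed.

Lemma Gfun_entries t (A : 'M[R[i]]_(d ^ t * d ^ t)) (U : UBorel R d) :
  Gfun A U = \sum_p \sum_q A p q *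
    gentry (mxtens_unindex q).1 (mxtens_unindex p).1
           (mxtens_unindex q).2 (mxtens_unindex p).2 U.
Proof.
rewrite /Gfun /mxtrace; apply: eq_bigr => p _; rewrite mxE; apply: eq_bigr => q _.
congr (_ * _); case: (mxtens_indexP p) => I K; case: (mxtens_indexP q) => J L.
by rewrite tensmxE !mxtens_indexK.
Qed.

(** The case t = 0 is separate because d ^ 1 reduces to d and not to d * 1; correspondingly the
    first tensor power is the matrix itself. *)
Definition cons_index {t} : 'I_d -> 'I_(d ^ t) -> 'I_(d ^ t.+1) :=
  match t with
  | 0 => fun i _ => i
  | t'.+1 => fun i J => mxtens_index (i, J)
  end.

Lemma ntensmx_cons t (A : 'M[R[i]]_d) (i j : 'I_d) (J I : 'I_(d ^ t)) :
  ntensmx A t.+1 (cons_index i J) (cons_index j I) = A i j * ntensmx A t J I.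
Proof.
case: t J I => [|t] J I /=; last by rewrite ntensmxSS tensmxE.
by rewrite ntensmx1 ntensmx0 (ord1 J) (ord1 I) mxE eqxx mulr1.
Qed.

Lemma gspan_mul_entries t g (i j k l : 'I_d) : gspan t g ->
  gspan t.+1 (fun U => umx U i j * conjc (umx U k l) * g U).
Proof.
move=> [A hA].
have h p q : gspan t.+1 (fun U => A p q *
    gentry (cons_index i (mxtens_unindex q).1) (cons_index j (mxtens_unindex p).1)
           (cons_index k (mxtens_unindex q).2) (cons_index l (mxtens_unindex p).2) U).
  by apply: gspanZ; apply: gspan_entry.
have := gspan_sum _ _ _ (fun p => gspan_sum _ _ _ (h p)).
apply: gspan_ext => U; rewrite -hA Gfun_entries mulr_sumr; apply: eq_bigr => p _.
rewrite mulr_sumr; apply: eq_bigr => q _.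
rewrite [in RHS]mulrCA; congr (_ * _); rewrite /gentry !ntensmx_cons /conj_umx mxE.
by rewrite mulrACA.
Qed.

Lemma sum_entries (U : UBorel R d) :
  \sum_i \sum_j umx U i j * conjc (umx U i j) = d%:R.
Proof.
have := congr1 mxtrace (mul_umx_adj U); rewrite mxtrace1 => <-.
apply: eq_bigr => i _; rewrite mxE; apply: eq_bigr => j _.
by rewrite !mxE.
Qed.

Hypothesis d_gt0 : (0 < d)%N.

(* The constants are reached through the identity sum_(i, j) |U_ij| ^ 2 = d. *)
Lemma gspanW t g : gspan t g -> gspan t.+1 g.
Proof.
move=> hg.
have := gspanZ _ d%:R^-1 _ (gspan_sum _ _ _ (fun i => gspan_sum _ _ _ (fun j =>
  gspan_mul_entries _ _ i j i j hg))).
apply: gspan_ext => U; under eq_bigr do rewrite -mulr_suml.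
by rewrite -mulr_suml sum_entries mulKf // pnatr_eq0 -lt0n.
Qed.

Lemma sqr_fid (W U : UBorel R d) : fid W U ^+ 2 = sqn (inner W U) / d%:R ^+ 2.
Proof. by rewrite /fid expr_div_n sqr_sqrtr // sqn_ge0. Qed.

Lemma gspan_mul_fid t g (W : UBorel R d) : gspan t g ->
  gspan t.+1 (fun U => (fid W U ^+ 2)%:C%C * g U).
Proof.
move=> hg.
have innerE U V : inner U V = \sum_i \sum_j conjc (umx U j i) * umx V j i.
  by apply: eq_bigr => i _; rewrite mxE; apply: eq_bigr => j _; rewrite !mxE.
have E (U : UBorel R d) : \sum_i \sum_j \sum_k \sum_l conjc (umx W j i) * umx W l k *
    (umx U j i * conjc (umx U l k) * g U) = (sqn (inner W U))%:C%C * g U.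
  rewrite -mulc_conj -inner_conj (mulrC (inner U W)) mulrAC !innerE.
  rewrite !mulr_suml; apply: eq_bigr => i _; rewrite !mulr_suml; apply: eq_bigr => j _.
  rewrite mulr_sumr; apply: eq_bigr => k _; rewrite mulr_sumr.
  by apply: eq_bigr => l _; ring.
have := gspanZ _ (d%:R ^- 2)%:C%C _ (gspan_sum _ _ _ (fun i => gspan_sum _ _ _ (fun j =>
  gspan_sum _ _ _ (fun k => gspan_sum _ _ _ (fun l =>
  gspanZ _ (conjc (umx W j i) * umx W l k) _ (gspan_mul_entries _ _ j i l k hg)))))).
by apply: gspan_ext => U; rewrite E sqr_fid mulrA -rmorphM /= mulrC [X in X%:C%C]mulrC mulrC.
Qed.

Lemma gspan_const t (c : R[i]) : gspan t (fun=> c).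
Proof.
suff h : gspan t (fun=> 1) by have := gspanZ _ c _ h; apply: gspan_ext => U; rewrite mulr1.
elim: t => [|t IH]; last exact: gspanW.
exists 1%:M => U; rewrite /Gfun mul1mx /mxtrace.
transitivity (\sum_(i < d ^ 0 * d ^ 0) (1 : R[i])).
  apply: eq_bigr => i _; case: (mxtens_indexP i) => a b.
  by rewrite tensmxE !ntensmx0 !mxE !eqxx mulr1.
by rewrite sumr_const card_ord expn0 muln1.
Qed.

(** Horner's scheme: each multiplication by the squared fidelity raises t by one, and constants are
    available at every t, so the terms of lower degree fit in as well. *)
Lemma gspan_horner t (W : UBorel R d) (p : {poly R}) : (size p <= t.+1)%N ->
  gspan t (fun U => (p.[fid W U ^+ 2])%:C%C).
Proof.
elim/poly_ind: p t => [|p c IH] t.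
  by move=> _; apply: gspan_ext (gspan0 t) => U; rewrite horner0.
rewrite size_MXaddC; case: ifP => [/andP[/eqP -> _] _|_].
  by apply: gspan_ext (gspan_const t c%:C%C) => U; rewrite mul0r add0r hornerC.
rewrite ltnS; case: t => [|t].
  rewrite leqn0 size_poly_eq0 => /eqP ->.
  by apply: gspan_ext (gspan_const 0 c%:C%C) => U; rewrite mul0r add0r hornerC.
move=> /IH h0; have h := gspan_mul_fid _ _ W h0.
have := gspan_lin _ 1 _ _ h (gspan_const _ c%:C%C).
apply: gspan_ext => U; rewrite hornerD hornerMX hornerC mul1r rmorphD [in RHS]rmorphM /=.
by congr (_ + _); rewrite mulrC.
Qed.

End DesignPolynomials.

(** * Haar measure of caps and support of a measure *)

Section Borel.
Context {R : realType} {d : nat}.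
Implicit Types (mu nu : probability (UBorel R d) R) (U V W : UBorel R d).

Lemma uopen_measurable (A : set (UBorel R d)) : uopen A -> measurable A.
Proof. by move=> oA; apply: sub_sigma_algebra. Qed.

(** A 1-Lipschitz function of one entry is continuous for the operator norm, so preimages of open
    half-lines are open. It is applied to real and imaginary parts. *)
Lemma measurable_entry (h : R[i] -> R) i j :
  (forall z w, (h z - h w) ^+ 2 <= sqn (z - w)) ->
  measurable_fun setT (fun U : UBorel R d => h (umx U i j)).
Proof.
move=> hP mD; apply: (measurability _ (RGenOInfty.measurableE R)) => //.
move=> _ [_ [r ->] <-]; rewrite setTI; apply: uopen_measurable => U /=.
rewrite in_itv /= andbT => rU; exists (h (umx U i j) - r); first by rewrite subr_gt0.
move=> V UV /=; rewrite in_itv /= andbT.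
have : (h (umx U i j) - h (umx V i j)) ^+ 2 < (h (umx U i j) - r) ^+ 2.
  apply: le_lt_trans (hP _ _) _.
  have := sqn_le_opnorm (val U - val V) i j; rewrite !mxE => /le_lt_trans; apply.
  by rewrite ltr_pXn2r // nnegrE ?opnorm_ge0 // subr_ge0 ltW.
move: rU; set a := h _; set b := h _ => ra hlt; rewrite ltNge; apply/negP => br; nra.
Qed.

Lemma measurable_Re i j : measurable_fun setT (fun U : UBorel R d => complex.Re (umx U i j)).
Proof. by apply: measurable_entry => -[a b] [c e]; rewrite /sqn /= lerDl sqr_ge0. Qed.

Lemma measurable_Im i j : measurable_fun setT (fun U : UBorel R d => complex.Im (umx U i j)).
Proof. by apply: measurable_entry => -[a b] [c e]; rewrite /sqn /= lerDr sqr_ge0. Qed.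

Lemma measurable_sqr_fid W : measurable_fun setT (fun U => fid W U ^+ 2).
Proof.
have E : (fun U => fid W U ^+ 2) = (fun U =>
   ((\sum_i \sum_j (complex.Re (umx W j i) * complex.Re (umx U j i) +
     complex.Im (umx W j i) * complex.Im (umx U j i))) ^+ 2 +
   (\sum_i \sum_j (complex.Re (umx W j i) * complex.Im (umx U j i) -
     complex.Im (umx W j i) * complex.Re (umx U j i))) ^+ 2) / d%:R ^+ 2).
  apply/funext => U; rewrite sqr_fid /sqn /inner /mxtrace Re_sum Im_sum.
  congr ((_ ^+ 2 + _ ^+ 2) / _); apply: eq_bigr => i _; rewrite mxE (Re_sum, Im_sum);
    apply: eq_bigr => j _; rewrite !mxE; case: (umx W j i) => a b;
    case: (umx U j i) => c e /=; ring.
rewrite E; apply: measurable_funM => //; apply: measurable_funD; apply: measurable_funX.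
  apply: measurable_sum => i; apply: measurable_sum => j.
  by apply: measurable_funD; apply: measurable_funM => //; [apply: measurable_Re|apply: measurable_Im].
apply: measurable_sum => i; apply: measurable_sum => j.
by apply: measurable_funB; apply: measurable_funM => //; [apply: measurable_Im|apply: measurable_Re].
Qed.

Lemma measurable_horner (p : {poly R}) (x : UBorel R d -> R) :
  measurable_fun setT x -> measurable_fun setT (fun U => p.[x U]).
Proof.
move=> mx; elim/poly_ind: p => [|p c IH].
  by under eq_fun do rewrite horner0; apply: measurable_cst.
under eq_fun do rewrite hornerD hornerMX hornerC.
by apply: measurable_funD => //; apply: measurable_funM.
Qed.

Lemma measurable_fid_ge W (r : R) : measurable [set U : UBorel R d | r <= fid W U ^+ 2].
Proof.
have := measurable_sqr_fid W measurableT _ (measurable_itv `[r, +oo[).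
rewrite setTI; congr measurable; apply/seteqP; split => U /=; by rewrite in_itv /= andbT.
Qed.

(** The cap around V is the left translate by V of the cap around the identity, because tr(V^* V X)
    = tr X. *)
Lemma haar_fid_ge mu V W (r : R) : isHaar mu ->
  mu [set U : UBorel R d | r <= fid V U ^+ 2] = mu [set U : UBorel R d | r <= fid W U ^+ 2].
Proof.
move=> hmu; pose One : UBorel R d := Unitary (is_unitary1 R d).
suff h (V' : UBorel R d) : mu [set U : UBorel R d | r <= fid V' U ^+ 2] =
    mu [set U : UBorel R d | r <= fid One U ^+ 2].
  transitivity (mu [set U : UBorel R d | r <= fid One U ^+ 2]); first exact: h.
  by symmetry; exact: h.
apply: etrans _ (hmu V' _ (measurable_fid_ge One r)).
apply: (congr1 (fun S => mu S)).
have e U : inner One U = \tr (umx U).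
  by rewrite /inner /adjmx /= trmx1 map_mx1 mul1mx.
apply/seteqP; split => U /=.
  move=> h; exists (umul (uadj V') U); last first.
    by rewrite /= mulmxA mul_umx_adj mul1mx.
  by move: h; rewrite /= /fid e.
move=> [X h UE]; move: h; rewrite /fid e /inner UE mulmxA mul_adj_umx.
by rewrite mul1mx.
Qed.

Lemma integrable_step_term mu (c : R) (A : set (UBorel R d)) :
  measurable A -> mu.-integrable setT (fun U => (c * \1_A U)%:E).
Proof.
move=> mA; under eq_fun do rewrite EFinM.
by apply: integrableZl => //; apply: integrable_indic.
Qed.

Lemma integral_step mu (I : finType) (c : I -> R) (A : I -> set (UBorel R d)) (m : R) :
  (forall i, measurable (A i)) -> (forall i, mu (A i) = m%:E) ->
  (\int[mu]_U (\sum_i c i * \1_(A i) U)%:E = ((\sum_i c i) * m)%:E)%E.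
Proof.
move=> mA muA.
have int i : mu.-integrable setT (fun U => (c i * \1_(A i) U)%:E).
  exact: integrable_step_term.
under eq_integral do rewrite -sumEFin.
rewrite integral_sum // mulr_suml -sumEFin; apply: eq_bigr => i _.
under eq_integral do rewrite EFinM.
rewrite integralZl //; last exact: integrable_indic.
by rewrite integral_indic // setIT EFinM; congr (_ * _)%E; apply: muA.
Qed.

Lemma bounded_integrable mu (f : UBorel R d -> R) (B : R) :
  measurable_fun setT f -> (forall U, `|f U| <= B) ->
  mu.-integrable setT (fun U => (f U)%:E).
Proof.
move=> mf fB; apply: measurable_bounded_integrable => //.
  by apply: le_lt_trans (probability_le1 _ _) (ltry _).
exists B; split; first exact: num_real.
by move=> y yB U _; apply: le_trans (fB U) (ltW yB).
Qed.

(** The sets may overlap and share one measure m. They will be caps, which are measurable and equal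
    in measure by invariance; no measurability of the grid cells is required. *)
Lemma integral_ge_step mu (f : UBorel R d -> R) (B : R)
    (I : finType) (c : I -> R) (A : I -> set (UBorel R d)) (m : R) :
  measurable_fun setT f -> (forall U, `|f U| <= B) ->
  (forall i, measurable (A i)) -> (forall i, mu (A i) = m%:E) ->
  (forall U, \sum_i c i * \1_(A i) U <= f U) ->
  (((\sum_i c i) * m)%:E <= \int[mu]_U (f U)%:E)%E.
Proof.
move=> mf fB mA muA le_f; rewrite -(@integral_step mu I c A m) //.
apply: le_integral => //.
- under eq_fun do rewrite -sumEFin.
  by apply: integrable_sum => // i _; apply: integrable_step_term.
- exact: bounded_integrable mf fB.
- by move=> U _; rewrite lee_fin.
Qed.

(** Total boundedness of the unitary group: its entries are bounded, and mesh g gives a squared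
    Frobenius distance of at most 2 d^2 g^2. The successor in the mesh keeps it positive for d = 0
    and makes the inequality strict. *)
Lemma opnorm_grid (r : R) : 0 < r ->
  exists (T : finType) (code : UBorel R d -> T),
    forall U V, code U = code V -> opnorm (val U - val V) < r.
Proof.
move=> r0.
pose f (U : UBorel R d) (c : 'I_d * 'I_d * bool) : R :=
  if c.2 then complex.Re (umx U c.1.1 c.1.2) else complex.Im (umx U c.1.1 c.1.2).
have fB U c : `|f U c| <= d%:R.
  rewrite -(@ler_sqr _ `|_|) ?nnegrE // real_normK ?num_real //.
  apply: le_trans (coord_sqr_le _ _) _; rewrite frob2_trace mul_adj_umx mxtrace1.
  have -> : (d%:R : R[i]) = d%:R%:C%C by rewrite rmorph_nat.
  by rewrite /= -natrX ler_nat -mulnn; case: (d) => // n; rewrite leq_pmulr.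
pose g := r / (2 * d.+1%:R).
have g0 : 0 < g by rewrite divr_gt0.
have [M [code [_ c2]]] := @grid_code _ _ _ f _ g g0 fB.
exists {ffun 'I_d * 'I_d * bool -> 'I_M * bool}, code => U V /c2 e.
apply: le_lt_trans (opnorm_le_frob _) _.
rewrite -[ltRHS]ger0_norm ?(ltW r0) // -sqrtr_sqr ltr_sqrt ?exprn_gt0 //.
have : frob2 (val U - val V) <= (2 * d ^ 2)%:R * g ^+ 2.
  rewrite frob2_coords.
  apply: (@le_trans _ _ (\sum_(c : 'I_d * 'I_d * bool) g ^+ 2)).
    apply: ler_sum => c _; have := e c; rewrite -(@ler_sqr _ `|_|) ?nnegrE ?(ltW g0) //.
    rewrite real_normK ?num_real // /f; case: c => -[i j] [] /=;
      by rewrite !mxE; do 2![case: (umx _ _ _) => ? ? /=].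
  by rewrite sumr_const card_coords -[g ^+ 2 *+ _]mulr_natl.
move=> /le_lt_trans; apply.
have -> : r ^+ 2 = (2 * d.+1%:R) ^+ 2 * g ^+ 2.
  by rewrite -exprMn /g mulrC divfK // gt_eqF.
by rewrite ltr_pM2r ?exprn_gt0 // -natrM -natrX ltr_nat expnMn; apply: ltn_mul => //; rewrite ltn_sqr ltnSn.
Qed.

(** The complement is a union of null open sets, which has to be made countable. [E n] holds the
    points whose ball of radius 1/(n+1) lies in a null open set; a finite grid of that mesh covers
    [E n] by finitely many of these sets, one for each occupied cell. *)
Lemma negligible_setC_msupport nu : nu.-negligible (~` msupport nu).
Proof.
pose E (n : nat) : set (UBorel R d) := [set U | exists G : set (UBorel R d),
  [/\ uopen G, nu G = 0%E & forall V : UBorel R d, opnorm (val U - val V) < n.+1%:R^-1 -> G V]].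
apply: (@negligibleS _ _ _ _ (\bigcup_n E n)).
  move=> U /existsNP[G /not_implyP[oG /not_implyP[GU /negP]]].
  rewrite -leNgt => nuG; have {}nuG : nu G = 0%E by apply/eqP; rewrite eq_le nuG measure_ge0.
  have [r r0 hr] := oG U GU.
  have [n nr] : exists n : nat, n.+1%:R^-1 < r.
    exists (Num.truncn r^-1); rewrite invf_plt ?posrE //; exact: truncnS_gt.
  by exists n => //; exists G; split => // V UV; apply: hr; apply: lt_trans nr.
apply: negligible_bigcup => n.
have [T [code codeP]] : exists (T : finType) (code : UBorel R d -> T),
    forall U V, code U = code V -> opnorm (val U - val V) < n.+1%:R^-1.
  by apply: opnorm_grid; rewrite invr_gt0.
have h z : exists G, nu.-negligible G /\ forall U, E n U -> code U = z -> G U.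
  have [[U [G [oG nuG hG]] Uz]|none] := pselect (exists2 U, E n U & code U = z).
    exists G; split; first by apply/negligibleP => //; apply: uopen_measurable.
    by move=> V _ Vz; apply: hG; apply: codeP; rewrite Uz Vz.
  exists set0; split; first exact: negligible_set0.
  by move=> U EU Uz; apply: none; exists U.
have [F FP] := boolp.choice h.
apply: (@negligibleS _ _ _ _ (\bigcup_k if unpickle k is Some z then F z else set0)).
  by move=> U EU; exists (pickle (code U)) => //; rewrite pickleK; apply: (FP _).2.
apply: negligible_bigcup => k; case: unpickle => [z|]; last exact: negligible_set0.
exact: (FP z).1.
Qed.

Lemma integral_le0_support nu (f : UBorel R d -> R) (B : R) :
  measurable_fun setT f -> (forall U, `|f U| <= B) ->
  (forall U, msupport nu U -> f U <= 0) -> (\int[nu]_U (f U)%:E <= 0)%E.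
Proof.
move=> mf fB f0; have [N [mN nuN subN]] := negligible_setC_msupport nu.
rewrite (@negligible_integral _ _ _ _ _ N) //; last exact: bounded_integrable mf fB.
rewrite -(integral0 nu (setT `\` N)); apply: le_integral.
- by apply: measurableD.
- by apply: integrableS (bounded_integrable _ _ _ mf fB) => //; apply: measurableD.
- exact: integrable0.
- move=> U; rewrite inE => -[_ NU]; rewrite lee_fin; apply: f0.
  by apply: contrapT => /subN.
Qed.

End Borel.

(** * Positivity of the Haar integral of the test polynomial *)

Lemma horner_bounded {R : realFieldType} (p : {poly R}) :
  exists B, forall x, 0 <= x <= 1 -> `|p.[x]| <= B.
Proof.
exists (\sum_(i < size p) `|p`_i|) => x /andP[x0 x1].
rewrite horner_coef; apply: le_trans (ler_norm_sum _ _ _) _; apply: ler_sum => i _.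
by rewrite normrM ler_piMr // ger0_norm ?exprn_ge0 // exprn_ile1.
Qed.

Section TestPolynomial.
Context {R : realType}.

Definition nfejer m : {poly R} := m%:R ^- 2 *: fejer m.

(** The power k pays for the sum over the cells. The extra factor is spent on a - x, using that (1 -
    x) times the normalised kernel is at most 1 / m^2. *)
Definition test_poly m k (a : R) : {poly R} := nfejer m ^+ k.+1 * ('X - a%:P).

Lemma size_test_poly m k (a : R) : (size (test_poly m.+1 k a) <= (k.+1 * m).+2)%N.
Proof.
apply: leq_trans (size_polyMleq _ _) _; rewrite size_XsubC addn2 /= ltnS.
apply: leq_trans (size_poly_exp_leq _ _) _; rewrite ltnS mulnC leq_mul2l /=.
have : (size (nfejer m.+1) <= m.+1)%N by apply: leq_trans (size_scale_leq _ _) (size_fejer _).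
by case: (size _).
Qed.

Lemma horner_nfejer m x : (nfejer m).[x] = (fejer m).[x] / m%:R ^+ 2.
Proof. by rewrite hornerZ mulrC. Qed.

Lemma horner_test_poly m k (a x : R) :
  (test_poly m k a).[x] = (nfejer m).[x] ^+ k.+1 * (x - a).
Proof. by rewrite hornerM horner_exp !hornerE. Qed.

Lemma nfejer_ge0 m x : 0 <= x <= 1 -> 0 <= (nfejer m).[x].
Proof. by move=> x01; rewrite horner_nfejer divr_ge0 ?fejer_ge0 ?sqr_ge0. Qed.

Lemma nfejer_decay m x : (0 < m)%N -> 0 <= x <= 1 ->
  (1 - x) * (nfejer m).[x] <= m%:R ^- 2.
Proof.
move=> m0 x01; rewrite horner_nfejer mulrA ler_pdivrMr ?exprn_gt0 ?ltr0n //.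
by rewrite mulVf ?fejer_decay // expf_neq0 // pnatr_eq0 -lt0n.
Qed.

Lemma nfejer_near m x : (0 < m)%N -> 0 <= x <= 1 -> 1 - 3 / 5 / m%:R ^+ 2 <= x ->
  4 / 5 <= (nfejer m).[x].
Proof.
move=> m0 x01 xm; rewrite horner_nfejer ler_pdivlMr ?exprn_gt0 ?ltr0n //.
apply: le_trans (fejer_ge _ _ x01); rewrite mulrC.
have M0 : 0 < m%:R ^+ 2 :> R by rewrite exprn_gt0 ?ltr0n.
rewrite ler_pM2l //.
have : m%:R ^+ 2 * (1 - x) <= 3 / 5; last by lra.
by rewrite mulrC -ler_pdivlMr //; lra.
Qed.

(** When 1 - h is the square root of the fidelity, [10 / 3 * h * m ^ 2] is the mean square of the
    coordinates measured in units of the cell side chosen in [integral_test_poly_gt0]. *)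
Lemma nfejer_far m (h0 h : R) : (0 < m)%N -> 0 < h0 <= 1 / 4 -> 25 / 8 <= m%:R ^+ 2 * h0 ->
  h0 <= h <= 1 -> (nfejer m).[(1 - h) ^+ 2] <= (3 / 20 * (26 + 10 / 3 * h * m%:R ^+ 2))^-1.
Proof.
move=> m0 /andP[h00 h01] mh /andP[hh h1].
have M0 : 0 < m%:R ^+ 2 :> R by rewrite exprn_gt0 ?ltr0n.
have x01 : 0 <= (1 - h) ^+ 2 <= 1 by rewrite sqr_ge0 /= expr_le1 //; lra.
have K0 := nfejer_ge0 m _ x01; have := nfejer_decay _ _ m0 x01.
set K := _.[_] in K0 *; set M := m%:R ^+ 2 in M0 mh *.
rewrite -(ler_pM2l M0) divff ?gt_eqF // => dec.
have hM : 0 < h * M by rewrite mulr_gt0 //; lra.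
have D0 : 0 < 3 / 20 * (26 + 10 / 3 * h * M) by nra.
rewrite -[leRHS]mul1r ler_pdivlMr //; apply: le_trans dec.
have -> : M * ((1 - (1 - h) ^+ 2) * K) = K * (M * (h * (2 - h))) by ring.
rewrite ler_wpM2l //.
(* The goal amounts to M h (3/2 - h) >= 39/10. The left side is smallest at h0, where it is at least
   (5/4) (25/8) = 125/32. *)
have key : h0 * (3 / 2 - h0) <= h * (3 / 2 - h).
  have : 0 <= (h - h0) * (3 / 2 - h - h0) by rewrite mulr_ge0 //; lra.
  lra.
have := ler_wpM2l (ltW M0) key.
have : 5 / 4 * (M * h0) <= M * (h0 * (3 / 2 - h0)) by rewrite mulrA mulrC ler_wpM2l //; lra.
lra.
Qed.

(** The value 4/5 is the lower bound of [nfejer_near], and [2 * (20 / 3) ^ 2 * (9 / 1250) = (4 / 5) ^ 2]. *)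
Lemma sum_cell_weight M :
  \sum_(z : 'I_M * bool) (3 / 20 * (26 + z.1%:R ^+ 2)) ^- 2 <= (4 / 5) ^+ 2 :> R.
Proof.
rewrite -(pair_bigA _ (fun (z : 'I_M) (b : bool) => (3 / 20 * (26 + z%:R ^+ 2)) ^- 2)) /=.
rewrite (eq_bigr (fun z : 'I_M => 2 * (3 / 20) ^- 2 * (26 + z%:R ^+ 2) ^- 2)); last first.
  by move=> z _; rewrite big_bool /= exprMn invfM; ring.
rewrite -mulr_sumr; have := @sum_inv_quartic_le R M; set S := \sum_(_ < _) _ => hS.
apply: (@le_trans _ _ (2 * (3 / 20) ^- 2 * (9 / 1250))); first by rewrite ler_pM2l.
by have -> : 2 * (3 / 20) ^- 2 * (9 / 1250) = (4 / 5) ^+ 2 :> R by field.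
Qed.

Lemma prod_le_mean_pow (I : finType) (z : I -> nat) : (0 < #|I|)%N ->
  \prod_(i : I) (26 + (z i)%:R ^+ 2 : R) <= (26 + (\sum_i (z i)%:R ^+ 2) / #|I|%:R) ^+ #|I|.
Proof.
move=> I0; have := @leif_AGM R I [pred i | true] (fun i => 26 + (z i)%:R ^+ 2).
case=> [i _|+ _]; first by rewrite addr_ge0 ?sqr_ge0.
rewrite /= big_split /= sumr_const.
have -> : #|[pred _ : I | true]| = #|I| by apply: eq_card.
rewrite mulrDl -[26 *+ _]mulr_natr mulfK ?pnatr_eq0 -?lt0n //.
Qed.

(** The bound on K depends only on the mean square of the indices; AM-GM replaces it by a product
    over the coordinates, whose sum over all z factorises. *)
Lemma pow_le_prod (I : finType) (z : I -> nat) (K s : R) : (0 < #|I|)%N -> 0 <= K ->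
  (\sum_i (z i)%:R ^+ 2) / #|I|%:R <= s -> K <= (3 / 20 * (26 + s))^-1 ->
  K ^+ (2 * #|I|) <= \prod_i (3 / 20 * (26 + (z i)%:R ^+ 2)) ^- 2.
Proof.
move=> I0 K0 zs Ks.
have t0 i : 0 < 3 / 20 * (26 + (z i)%:R ^+ 2) :> R by rewrite mulr_gt0 // ltr_pwDl ?sqr_ge0.
set q := (\sum_i _) / _ in zs.
have q0 : 0 <= q by rewrite divr_ge0 // sumr_ge0 // => i _; rewrite sqr_ge0.
have D0 : 0 < 3 / 20 * (26 + s) by rewrite mulr_gt0 //; lra.
rewrite mulnC exprM prodfV prodrXl -exprVn lerXn2r ?nnegrE ?exprn_ge0 //.
  by rewrite invr_ge0 prodr_ge0 // => i _; rewrite ltW.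
apply: (@le_trans _ _ ((3 / 20 * (26 + s))^-1 ^+ #|I|)); first by rewrite lerXn2r ?nnegrE // invr_ge0 ltW.
rewrite exprVn lef_pV2 ?posrE ?exprn_gt0 ?prodr_gt0 //.
have -> : \prod_i (3 / 20 * (26 + (z i)%:R ^+ 2)) =
    (3 / 20) ^+ #|I| * \prod_i (26 + (z i)%:R ^+ 2) :> R.
  by rewrite big_split /= prodr_const.
rewrite [leRHS]exprMn ler_pM2l ?exprn_gt0 //.
apply: le_trans (prod_le_mean_pow _ _ I0) _.
by rewrite lerXn2r ?nnegrE -/q; lra.
Qed.

End TestPolynomial.

Lemma sum_option {R : nmodType} (T : finType) (F : option T -> R) :
  \sum_o F o = F None + \sum_z F (Some z).
Proof.
rewrite (bigD1 None) //=; congr (_ + _); rewrite (reindex_omap Some id) //=; last by case.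
by apply: eq_bigl => z; rewrite eqxx.
Qed.

Section HaarIntegral.
Context {R : realType} {d : nat}.
Variable mu : probability (UBorel R d) R.
Hypotheses (d_gt0 : (0 < d)%N) (haar_mu : isHaar mu).
Implicit Types (U V W : UBorel R d).

Lemma sqr_fid01 W U : 0 <= fid W U ^+ 2 <= 1.
Proof. by rewrite sqr_ge0 expr_le1 ?fid_le1 ?fid_ge0. Qed.

Lemma integrand_bounded W (p : {poly R}) : exists B, forall U, `|p.[fid W U ^+ 2]| <= B.
Proof. by have [B hB] := horner_bounded p; exists B => U; apply: hB; apply: sqr_fid01. Qed.

Lemma measurable_integrand W (p : {poly R}) :
  measurable_fun setT (fun U => p.[fid W U ^+ 2]).
Proof. exact: measurable_horner (measurable_sqr_fid W). Qed.

Lemma integral_test_poly_gt0 W m (h0 : R) : (0 < m)%N -> 0 < h0 <= 1 / 4 ->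
  25 / 8 <= m%:R ^+ 2 * h0 ->
  (0 < \int[mu]_U ((test_poly m (4 * d ^ 2) ((1 - h0) ^+ 2)).[fid W U ^+ 2])%:E)%E.
Proof.
move=> m0 h0b mh; have /andP[h00 h01] := h0b.
have dR : 0 < d%:R :> R by rewrite ltr0n.
set k := (4 * d ^ 2)%N; set a := (1 - h0) ^+ 2; set p := test_poly m k a.
have M1 : 1 <= m%:R ^+ 2 :> R by rewrite expr_ge1 // ler1n.
set M := m%:R ^+ 2 in M1 mh; have M0 : 0 < M by lra.
pose v0 := 3 / 5 / M.
have v0M : v0 * M = 3 / 5 by rewrite divfK // gt_eqF.
(* The side makes 2 d g^2 = v0. Two points of a cell then have fidelity root at least 1 - d g^2,
   whose square is at least 1 - v0, so each cell lies in the cap around any of its points. *)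
pose g := Num.sqrt (3 / (10 * d%:R * M)).
have gb0 : 0 < 3 / (10 * d%:R * M) by rewrite divr_gt0 // mulr_gt0 // mulr_gt0.
have g0 : 0 < g by rewrite sqrtr_gt0.
have g2 : g ^+ 2 = 3 / (10 * d%:R * M) by rewrite sqr_sqrtr // ltW.
have dg2 : 2 * (d%:R * g ^+ 2) = v0 by rewrite g2 /v0; field; rewrite !gt_eqF.
have [N [code [c1 c2]]] := normalised_cells d_gt0 W g g0.
(* A representative of each cell; an empty cell receives the arbitrary value W. *)
have [rep repP] : exists rep : {ffun 'I_d * 'I_d * bool -> 'I_N * bool} -> UBorel R d,
    forall U, code (rep (code U)) = code U.
  have h z : exists V, forall U, code U = z -> code V = z.
    have [[V Vz]|none] := pselect (exists V, code V = z); first by exists V.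
    by exists W => U Uz; case: none; exists U.
  by have [rep repP] := boolp.choice h; exists rep => U; apply: repP.
pose A V : set (UBorel R d) := [set U | 1 - v0 <= fid V U ^+ 2].
have mA V : measurable (A V) by apply: measurable_fid_ge.
pose mA0 := fine (mu (A W)).
have muA V : mu (A V) = mA0%:E.
  have -> : mu (A V) = mu (A W).
    exact: (haar_fid_ge mu V W (1 - v0) haar_mu).
  by symmetry; apply: fineK; apply: fin_num_measure; apply: mA.
have inA U : A (rep (code U)) U.
  have := c2 _ _ (repP U); have := fid_ge0 (rep (code U)) U; rewrite /A /=.
  have : 0 < d%:R * g ^+ 2 by rewrite mulr_gt0 ?exprn_gt0.
  set f := fid _ _; nra.
have AE V U : A V U <-> 1 - v0 <= fid V U ^+ 2 by [].
clearbody A.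
(* The finitely many caps cover the group. If they were null, integrating -1 >= minus the sum of
   their indicators would give -1 >= 0. *)
have mA0_gt0 : 0 < mA0.
  have mA00 : 0 <= mA0 by rewrite fine_ge0.
  have n1 : `|-1| <= 1 :> R by rewrite normrN normr1.
  have cover U : \sum_(z : {ffun 'I_d * 'I_d * bool -> 'I_N * bool}) -1 * \1_(A (rep z)) U <= -1 :> R.
    rewrite (bigD1 (code U) isT) indicE (mem_set (inA U)) mulr1 gerDl; apply: sumr_le0 => z _.
    by rewrite mulN1r oppr_le0.
  have := @integral_ge_step R d mu (fun=> -1) 1 _ (fun=> -1) (fun z => A (rep z)) mA0
    (measurable_cst _) (fun=> n1) (fun=> mA _) (fun=> muA _) cover.
  have -> : (\int[mu]_(U in setT) (-1)%:E = (-1)%:E)%E.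
    rewrite (integral_cst mu measurableT (-1)%:E) [X in (_ * X)%E](_ : _ = 1%E) ?mule1 //.
    exact: (@probability_setT _ _ _ mu).
  rewrite lee_fin => h.
  by rewrite lt_neqAle mA00 andbT; apply/eqP => m00; move: h; rewrite -m00 mulr0; lra.
pose psi (z : {ffun 'I_d * 'I_d * bool -> 'I_N * bool}) : R :=
  \prod_i (3 / 20 * (26 + (z i).1%:R ^+ 2)) ^- 2.
have psi0 z : 0 <= psi z.
  by apply: prodr_ge0 => i _; rewrite invr_ge0 exprn_ge0 // mulr_ge0 // addr_ge0 // sqr_ge0.
have cardI := card_coords (d := d).
have cardI0 : (0 < #|{: 'I_d * 'I_d * bool}|)%N by rewrite cardI muln_gt0 expn_gt0 d_gt0.
have kE : k = (2 * #|{: 'I_d * 'I_d * bool}|)%N by rewrite cardI mulnA.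
(* The sum over all index functions of a product is a product of 2 d^2 equal sums, each at most
   (4/5)^2. *)
have sum_psi : \sum_z psi z <= (4 / 5) ^+ k.
  rewrite /psi -(bigA_distr_bigA (fun (i : 'I_d * 'I_d * bool) (z : 'I_N * bool) =>
    (3 / 20 * (26 + z.1%:R ^+ 2)) ^- 2 : R)) /= prodr_const kE exprM.
  rewrite lerXn2r ?nnegrE //; last exact: sum_cell_weight.
  by apply: sumr_ge0 => z _; rewrite invr_ge0 exprn_ge0 // mulr_ge0 // addr_ge0 // sqr_ge0.
have far U : fid W U ^+ 2 < a -> (nfejer m).[fid W U ^+ 2] ^+ k <= psi (code U).
  move=> xa; set h := 1 - fid W U.
  have fidE : fid W U = 1 - h by rewrite /h; ring.
  have f0 := fid_ge0 W U; have f1 := fid_le1 d_gt0 W U.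
  have hh : h0 <= h <= 1.
    have fx : fid W U < 1 - h0.
      rewrite ltNge; apply/negP => le_f; move: xa; rewrite ltNge => /negP; apply.
      by rewrite /a lerXn2r ?nnegrE //; lra.
    by rewrite /h; apply/andP; split; lra.
  rewrite kE; apply: (pow_le_prod _ (fun i => (code U i).1) _ (10 / 3 * h * M)) => //.
  - exact: nfejer_ge0 (sqr_fid01 _ _).
  - have := c1 U; rewrite -/h g2 cardI; set S := \sum_c _ => hS.
    rewrite ler_pdivrMr ?ltr0n ?muln_gt0 ?expn_gt0 ?d_gt0 //.
    have D0 : 0 < 10 * d%:R * M by rewrite mulr_gt0 // mulr_gt0.
    by move: hS; rewrite -(ler_pM2r D0) -[S * _ * _]mulrA divfK ?gt_eqF // natrM natrX; lra.
  - by rewrite fidE; apply: nfejer_far h0b mh hh.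
have aE : 1 - a = h0 * (2 - h0) by rewrite /a; ring.
(* The step function below p: [None] is the cap around W, carrying the guaranteed gain, and [Some z]
   is the cap containing cell z, carrying its largest possible loss. *)
pose c (o : option {ffun 'I_d * 'I_d * bool -> 'I_N * bool}) : R :=
  if o is Some z then - (psi z / M) else (4 / 5) ^+ k.+1 * (1 - v0 - a).
pose B o := if o is Some z then A (rep z) else A W.
(* M (1 - a) = M h0 (2 - h0) is at least (25/8) (7/4), and M v0 = 3/5. *)
have gap : M * (1 - v0 - a) >= 4 by nra.
have gap0 : 0 <= 1 - v0 - a by nra.
have step U : \sum_o c o * \1_(B o) U <= p.[fid W U ^+ 2].
  have x01 := sqr_fid01 W U; have K0 := nfejer_ge0 m _ x01.
  rewrite sum_option /= horner_test_poly.
  have S0 : \sum_z - (psi z / M) * \1_(A (rep z)) U <= - (psi (code U) / M) :> R.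
    rewrite (bigD1 (code U) isT) indicE (mem_set (inA U)) mulr1 gerDl; apply: sumr_le0 => z _.
    by rewrite mulNr oppr_le0 mulr_ge0 // divr_ge0 // ltW.
  have psiM : 0 <= psi (code U) / M by rewrite divr_ge0 // ltW.
  have [near|nfar] := leP (1 - v0) (fid W U ^+ 2).
    rewrite (_ : \1_(A W) U = 1); last by rewrite indicE mem_set //; apply/AE.
    have Kn := nfejer_near _ _ m0 x01 near.
    rewrite mulr1 -[leRHS]addr0; apply: lerD; last by lra.
    have q0 : 0 <= (4 / 5 : R) ^+ k.+1 by apply: exprn_ge0.
    have qK : (4 / 5 : R) ^+ k.+1 <= (nfejer m).[fid W U ^+ 2] ^+ k.+1.
      by rewrite lerXn2r ?nnegrE.
    by apply: (ler_pM q0 gap0 qK); rewrite lerD2r.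
  rewrite (_ : \1_(A W) U = 0); last first.
    by rewrite indicE memNset // => /AE; apply/negP; rewrite -ltNge.
  rewrite mulr0 add0r; apply: le_trans S0 _.
  have [xa|xa] := leP a (fid W U ^+ 2).
    apply: (@le_trans _ _ 0); first by lra.
    by rewrite mulr_ge0 ?exprn_ge0 // subr_ge0.
  (* The first k kernel factors are bounded by [far]; the last one times a - x is at most 1 / M
     because a <= 1. *)
  have dec := nfejer_decay _ _ m0 x01.
  rewrite -opprB mulrN lerN2 exprSr -mulrA.
  apply: ler_pM; rewrite ?exprn_ge0 ?far //; first by rewrite mulr_ge0 // subr_ge0 ltW.
  apply: le_trans dec; rewrite mulrC ler_wpM2r // lerD2r /a.
  by rewrite expr_le1 //; lra.
have [b hb] := integrand_bounded W p.
have := @integral_ge_step R d mu (fun U => p.[fid W U ^+ 2]) b _ c B mA0 (measurable_integrand W p) hb.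
move=> /(_ _ _ step) h; apply: lt_le_trans (h _ _) => [|[z|]|[z|]] //=.
rewrite lte_fin mulr_gt0 // sum_option /= sumrN -mulr_suml.
have : (\sum_z psi z) / M <= (4 / 5) ^+ k / M by rewrite ler_pM2r ?invr_gt0.
have q0 : 0 < (4 / 5 : R) ^+ k by rewrite exprn_gt0.
(* The gain exceeds the total loss because (4/5) times [gap] is greater than 1. *)
have : (4 / 5) ^+ k / M < (4 / 5) ^+ k.+1 * (1 - v0 - a).
  rewrite exprS [4 / 5 * _]mulrC -mulrA ltr_pM2l // -div1r ltr_pdivrMr //; lra.
lra.
Qed.

End HaarIntegral.

(** * The support of a design is a net *)

Theorem theorem2 (R : realType) (d : nat) (eps : R) (t : nat)
  (mu nu : probability (UBorel R d) R) :
  (2 <= d)%N -> 0 < eps <= 1 ->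
  isHaar mu ->
  exact_design t mu nu ->
  5 * (d%:R `^ (5 / 2)) / eps * tau eps d <= t%:R ->
  is_eps_net (msupport nu) eps.
Proof.
move=> d2 e01 hmu des ht W.
have d_gt0 : (0 < d)%N by apply: leq_trans d2.
have dR : 2 <= d%:R :> R by rewrite ler_nat.
have [m [hm mt]] := exists_fejer_degree eps d t d2 e01 ht.
have /andP[e0 e1] := e01.
(* By [Dch_le], a fidelity root above 1 - h0 forces distance at most eps, so (1 - h0)^2 bounds the
   fidelity on a support that misses the eps-ball around W. *)
pose h0 := eps ^+ 2 / (2 * d%:R).
have h0E : 2 * d%:R * h0 = eps ^+ 2 by rewrite mulrC divfK // gt_eqF //; lra.
have h0b : 0 < h0 <= 1 / 4.
  rewrite divr_gt0 ?exprn_gt0 //=; last by lra.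
  by rewrite ler_pdivrMr; [nra|lra].
have mh : 25 / 8 <= m.+1%:R ^+ 2 * h0.
  have -> : 25 / 8 = 25 * d%:R / (4 * eps ^+ 2) * h0.
    by rewrite /h0; field; rewrite !gt_eqF //; lra.
  by rewrite ler_wpM2r // ltW //; case/andP: h0b.
set p := test_poly m.+1 (4 * d ^ 2) ((1 - h0) ^+ 2).
have pos := integral_test_poly_gt0 mu d_gt0 hmu W m.+1 h0 isT h0b mh.
have [|none] := pselect (exists2 V, msupport nu V & Dch (val W) (val V) <= eps); first by [].
exfalso.
have psize : (size p <= t.+1)%N.
  by apply: leq_trans (size_test_poly _ _ _) _; rewrite ltnS; apply: leq_trans mt; rewrite !addn1.
have [A hA] := gspan_horner d_gt0 t W p psize.
have [desA _] := des A.
have ReA U : complex.Re (Gfun A U) = p.[fid W U ^+ 2] by rewrite hA.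
have le0 U : msupport nu U -> p.[fid W U ^+ 2] <= 0.
  move=> sU; have f0 := fid_ge0 W U; have f1 := fid_le1 d_gt0 W U.
  have fh : fid W U <= 1 - h0.
    rewrite leNgt; apply/negP => fh; apply: none; exists U => //.
    apply: le_trans (Dch_le d_gt0 W U) _.
    rewrite -[leRHS](ger0_norm (ltW e0)) -sqrtr_sqr ler_wsqrtr // -h0E.
    by rewrite ler_pM2l ?mulr_gt0 //; lra.
  rewrite horner_test_poly mulr_ge0_le0 ?exprn_ge0 ?nfejer_ge0 ?sqr_fid01 //.
  by rewrite subr_le0 lerXn2r ?nnegrE //; lra.
have [b hb] := integrand_bounded d_gt0 W p.
have := integral_le0_support nu _ b (measurable_integrand W p) hb le0.
move: desA; under eq_integral do rewrite ReA.
under [X in _ = X -> _]eq_integral do rewrite ReA.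
by move=> ->; rewrite leNgt pos.
Qed.
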